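(* Let $u,v\in P$ with $\dim u=i$, $\dim v=j$ and $\dim(u\cap v)=h$. Then $$\langle\widehat{u},\widehat{v}\rangle=[n][h]-[i][j].$$
   Context: Let $\mathbb{F}_q$ be a finite field with $q$ elements, let $n,k$ be integers with $n>2k\geq 6$, and let $V$ be an $n$-dimensional vector space over $\mathbb{F}_q$. For $m\in\mathbb{Z}$ write $[m]=(q^m-1)/(q-1)$. Let $P$ be the set of all subspaces of $V$ and $P_1$ the set of $1$-dimensional subspaces. Let $E$ be a (real) Euclidean space of dimension $[n]-1$ with inner product $\langle\,,\,\rangle$, and let $P_1\to E$, $s\mapsto\widehat{s}$ be a map such that: $E=\mathrm{Span}\{\widehat{s}\mid s\in P_1\}$; $\|\widehat{s}\|^2=[n]-1$ for $s\in P_1$; $\langle\widehat{s},\widehat{t}\rangle=-1$ for distinct $s,t\in P_1$; and $\sum_{s\in P_1}\widehat{s}=0$. For $u\in P$ define $\widehat{u}=\sum_{s\in P_1,\,s\subseteq u}\widehat{s}$. *)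

(* Defs.v *)
From HB Require Import structures.
From mathcomp Require Import all_boot all_order all_algebra.
From mathcomp Require Import reals.

Set Implicit Arguments.
Unset Strict Implicit.
Unset Printing Implicit Defensive.

(* VectorInternalTheory provides the subType structure of {vspace V}. *)
Import GRing.Theory VectorInternalTheory.
Local Open Scope ring_scope.

HB.instance Definition _ (F : finFieldType) (V : vectType F) :=
  [Countable of {vspace V} by <:].
HB.instance Definition _ (F : finFieldType) (V : vectType F) :=
  [Finite of {vspace V} by <:].

Notation lines V := {s : {vspace V} | \dim s == 1%N}.

Definition qnum (R : realType) (q : nat) (m : int) : R :=
  (q%:R ^ m - 1) / (q%:R - 1).

(* On a line this agrees with hat, so it extends hat to all subspaces. *)
Definition hat_sum (F : finFieldType) (V : vectType F)
    (R : realType) (E : vectType R) (hat : lines V -> E)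
    (u : {vspace V}) : E :=
  \sum_(s : lines V | (val s <= u)%VS) hat s.

(* Main.v *)
Require Import Defs.
From mathcomp Require Import all_boot all_order all_algebra.
From mathcomp Require Import reals.
From mathcomp Require Import finfield.
Local Open Scope ring_scope.
Import GRing.Theory Num.Theory.

(** Expanding both sums by bilinearity, the inner product runs over the pairs
    (s, t) of lines with s inside u and t inside v.  The Gram matrix of the
    vectors [hat s] is [n] times the identity minus the all-ones matrix, so the
    sum is [n] times the number of lines inside both u and v, minus the number
    of lines in u times the number of lines in v ([dot_hat_sum]).  The lines
    inside both are the lines of the intersection, and a subspace of dimension d
    has [d] lines ([card_lines_qnum]), because its q^d - 1 nonzero vectors are
    split by the lines into classes of size q - 1. *)

Definition lines_in {F : finFieldType} {V : vectType F} (u : {vspace V}) :=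
  [pred s : lines V | (val s <= u)%VS].

(** [finvect_type V] is V with its finite type structure.  Its vector space
    structure is that of V only up to eta-expansion of records, so that V and its
    class have to be destructed before subspaces of the one are subspaces of the
    other. *)
Lemma card_finvect {F : finFieldType} {V : vectType F} (u : {vspace V}) :
  #|[pred x : finvect_type V | x \in u]| = (#|F| ^ \dim u)%N.
Proof.
case: V u => T; case=> *; exact: (@card_vspace F (finvect_type (Vector.Pack _))).
Qed.

Lemma card_vspace_nz {F : finFieldType} {V : vectType F} (u : {vspace V}) :
  #|[pred x : finvect_type V | (x \in u) && (x != 0)]| = (#|F| ^ \dim u).-1.
Proof.
rewrite -card_finvect [X in _ = X.-1](cardD1 (0 : finvect_type V)) inE
        (mem0v u : (0 : finvect_type V) \in u).
by apply: eq_card => x; rewrite !inE andbC.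
Qed.

(** Double counting of the pairs in the relation r: every x of B is paired with
    exactly one s of A, so that A splits B into classes of size m. *)
Lemma card_classes {S T : finType} {A : pred S} {B : pred T} {r : S -> pred T}
    {m : nat}
    (cardA : forall s, A s -> #|[pred x | B x && r s x]| = m)
    (cardB : forall x, B x -> #|[pred s | A s && r s x]| = 1%N) :
  (#|A| * m = #|B|)%N.
Proof.
rewrite -sum_nat_const -[RHS]sum1_card.
rewrite -[LHS](eq_bigr _ cardA) -[RHS](eq_bigr _ cardB).
under eq_bigr do rewrite -sum1_card big_mkcondr.
under [RHS]eq_bigr do rewrite -sum1_card big_mkcondr.
exact: exchange_big.
Qed.

(** A line is spanned by any of its nonzero vectors, so the only line through x
    is the span of x. *)
Lemma card_lines_through {F : finFieldType} {V : vectType F} {u : {vspace V}}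
    {x : V} :
  x \in u -> x != 0 -> #|[pred s : lines V | lines_in u s && (x \in val s)]| = 1%N.
Proof.
move=> xu x_nz; have dim_x : \dim <[x]> == 1%N by rewrite dim_vline x_nz.
have [l val_l] : exists l : lines V, val l = <[x]>%VS.
  by exists (exist _ <[x]>%VS dim_x).
have l_through (s : lines V) : (x \in val s) = (s == l).
  rewrite -val_eqE val_l eq_sym eqEdim (eqP (valP s)) (eqP dim_x) andbT.
  exact: memvE.
apply: (@eq_card1 _ l) => s; rewrite !inE l_through andb_idl // => /eqP ->.
by rewrite val_l -memvE.
Qed.

Lemma card_lines_in {F : finFieldType} {V : vectType F} (u : {vspace V}) :
  (#|lines_in u| * #|F|.-1 = (#|F| ^ \dim u).-1)%N.
Proof.
rewrite -card_vspace_nz.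
pose nz_in : pred (finvect_type V) := [pred x | (x \in u) && (x != 0)].
apply: (@card_classes _ _ (lines_in u) nz_in (fun s x => x \in val s)).
  move=> s /subvP s_u; have := card_vspace_nz (val s).
  rewrite (eqP (valP s)) expn1 => <-; apply: eq_card => x.
  by rewrite !inE andbAC (andb_idl (s_u x)).
by move=> x /andP[]; apply: card_lines_through.
Qed.

Lemma card_lines_qnum (R : realType) {F : finFieldType} {V : vectType F}
    (u : {vspace V}) :
  #|lines_in u|%:R = qnum R #|F| (\dim u) :> R.
Proof.
have q_gt1 : (1 < #|F|)%N := finNzRing_gt1 F.
have q1_nz : #|F|%:R - 1 != 0 :> R by rewrite subr_eq0 pnatr_eq1 gtn_eqF.
apply: (mulIf q1_nz); rewrite divfK // -exprnP -natrX.
have := congr1 (fun m => m%:R : R) (card_lines_in u).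
by rewrite natrM -!subn1 !natrB ?expn_gt0 ?(ltnW q_gt1).
Qed.

(** In the double sum over the lines s of u and t of v, the diagonal part of the
    Gram matrix keeps the pairs (s, s), one for each line common to u and v, and
    the all-ones part counts all the pairs. *)
Lemma dot_hat_sum {F : finFieldType} {V : vectType F} {R : realType}
    {E : vectType R} {dot : {dot E for idfun}} {hat : lines V -> E} {c : R}
    (gram : forall s t, dot (hat s) (hat t) = c *+ (s == t) - 1)
    (u v : {vspace V}) :
  dot (hat_sum hat u) (hat_sum hat v) =
    c * #|lines_in (u :&: v)|%:R - #|lines_in u|%:R * #|lines_in v|%:R.
Proof.
transitivity (\sum_(s in lines_in u) (c *+ (val s <= v)%VS - #|lines_in v|%:R)).
  rewrite linear_sumlz; apply: eq_bigr => s _.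
  rewrite linear_sumr (eq_bigr _ (fun t _ => gram s t)) sumrB; congr (_ - _).
    case: (boolP (val s <= v)%VS) => [sv | /negP sNv].
      rewrite (bigD1 s sv) /= eqxx big1 ?addr0 // => t /andP[_ /negPf].
      by rewrite eq_sym => ->.
    by rewrite big1 // => t tv; case: eqP => // st; rewrite st in sNv.
  by rewrite sumr_const.
rewrite sumrB sumr_const mulr_natr mulr_natl; congr (_ - _).
rewrite -sumr_const.
rewrite [RHS](eq_bigl (fun s => (s \in lines_in u) && (val s <= v)%VS)).
  by rewrite [RHS]big_mkcondr; apply: eq_bigr => s _; case: (_ <= v)%VS.
by move=> s; rewrite !inE subv_cap.
Qed.

Theorem lemma6p2
  (F : finFieldType) (q : nat) (hq : #|F| = q)
  (n k : nat) (hnk : (2 * k < n)%N) (hk : (6 <= 2 * k)%N)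
  (V : vectType F) (hV : \dim {: V} = n)
  (R : realType) (E : vectType R) (dot : {dot E for idfun})
  (hE : (\dim {: E})%:R = qnum R q n - 1)
  (hat : lines V -> E)
  (hspan : fullv = <<[seq hat s | s : lines V]>>%VS)
  (hnorm : forall s : lines V, dot (hat s) (hat s) = qnum R q n - 1)
  (hdot : forall s t : lines V, s <> t -> dot (hat s) (hat t) = -1)
  (hsum : \sum_(s : lines V) hat s = 0)
  (u v : {vspace V}) (i j h : nat)
  (hu : \dim u = i) (hv : \dim v = j) (huv : \dim (u :&: v) = h) :
  dot (hat_sum hat u) (hat_sum hat v) =
    qnum R q n * qnum R q h - qnum R q i * qnum R q j.
Proof.
rewrite (@dot_hat_sum _ _ _ _ _ _ (qnum R q n)).
  by rewrite !card_lines_qnum hq hu hv huv.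
by move=> s t; case: eqP => [<- | /hdot ->]; rewrite ?hnorm // sub0r.
Qed.
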